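(* Fix integers $r,t\ge 2$. Let $M$ be a rank-$r$ matroid on $(r-1)t+1$ elements such that for each $i\in[r]$ every rank-$i$ flat has at most $(i-1)t+1$ elements. For $i\in[r]$ call a rank-$i$ flat with $(i-1)t+1$ elements large, and call a flag large if it is one of the chains counted by $F_{0,r}(M;0,1,t+1,2t+1,\ldots,(r-1)t+1)$. Then $M$ has at most $(r-1)!\,(t+1)$ large flags, and $M$ has exactly $(r-1)!\,(t+1)$ large flags if and only if $M$ is an $(r,r-1,t+1)$-spike. Also, if $r>2$, then $M$ has at most $r-1$ large hyperplanes, and $M$ has exactly $(r-1)!\,(t+1)$ large flags if and only if $M$ has $r-1$ large hyperplanes.
   Context: All matroids are finite. For a matroid $N$ of rank $r$ and integers $s_0,\ldots,s_r$, $F_{0,r}(N;s_0,\ldots,s_r)$ is the number of chains $F_0\subsetneq\cdots\subsetneq F_r$ of flats with $r(F_i)=i$ and $|F_i|=s_i$. For $r\ge3$, an $(r,r-1,t+1)$-spike (with tip $a$) is a simple rank-$r$ matroid whose ground set is the union of $r-1$ lines, each with $t+1$ elements and each containing $a$, such that for every $k\in[r-1]$ the union of any $k$ of these lines has rank $k+1$ (equivalently, the parallel connection at $a$ of $r-1$ lines with $t+1$ elements each). By convention, a $(2,1,t+1)$-spike is a $(t+1)$-point line $U_{2,t+1}$. *)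

(* Defs.v *)
From mathcomp Require Import all_boot.

Set Implicit Arguments.
Unset Strict Implicit.
Unset Printing Implicit Defensive.

(* A matroid whose ground set is the whole finite type T, given by its rank
   function. *)
Record matroid (T : finType) := Matroid {
  rk :> {set T} -> nat;
  rk_le_card : forall A : {set T}, rk A <= #|A|;
  rk_mono : forall A B : {set T}, A \subset B -> rk A <= rk B;
  rk_submod : forall A B : {set T}, rk (A :|: B) + rk (A :&: B) <= rk A + rk B
}.

Section MatroidNotions.

Variables (T : finType) (M : matroid T).

Definition flat (F : {set T}) : bool :=
  [forall x, (x \notin F) ==> (rk M F < rk M (x |: F))].

Definition flat_of_rank (i : nat) (F : {set T}) : bool :=
  flat F && (rk M F == i).

(* No circuit has fewer than three elements. *)
Definition simple_matroid : Prop :=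
  forall A : {set T}, #|A| <= 2 -> rk M A = #|A|.

(* M is (isomorphic to) the uniform matroid U_{k,n}. *)
Definition uniform_matroid (k n : nat) : Prop :=
  #|T| = n /\ forall A : {set T}, rk M A = minn k #|A|.

(* The chains F_0 < ... < F_r counted by F_{0,r}(M; s_0, ..., s_r); this is
   meant for r equal to the rank of M. *)
Definition flag_set (r : nat) (s : 'I_r.+1 -> nat)
    : {set {ffun 'I_r.+1 -> {set T}}} :=
  [set F : {ffun 'I_r.+1 -> {set T}} |
     [forall i : 'I_r.+1, flat_of_rank i (F i) && (#|F i| == s i)]
     && [forall i : 'I_r.+1, forall j : 'I_r.+1, (i < j) ==> (F i \proper F j)]].

Definition F0r (r : nat) (s : 'I_r.+1 -> nat) : nat := #|flag_set s|.

(* 0, 1, t + 1, 2t + 1, ...: note the separate case of rank 0. *)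
Definition large_size (t i : nat) : nat :=
  if i is j.+1 then j * t + 1 else 0.

Definition num_large_flags (r t : nat) : nat :=
  F0r (fun i : 'I_r.+1 => large_size t i).

Definition large_flat (t i : nat) (F : {set T}) : bool :=
  flat_of_rank i F && (#|F| == i.-1 * t + 1).

Definition large_hyperplanes (r t : nat) : {set {set T}} :=
  [set H | large_flat t r.-1 H].

(* M is an (r, r-1, t+1)-spike with tip a, for r >= 3; Ls is the set of its
   r - 1 lines, a line being a flat of rank 2. *)
Definition spike_with_tip (r t : nat) (a : T) (Ls : {set {set T}}) : Prop :=
  [/\ simple_matroid,
      rk M [set: T] = r,
      #|Ls| = r.-1 /\ cover Ls = [set: T],
      forall L : {set T}, L \in Ls ->
        [/\ flat_of_rank 2 L, #|L| = t.+1 & a \in L] &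
      forall (k : nat) (K : {set {set T}}), 1 <= k <= r.-1 ->
        K \subset Ls -> #|K| = k -> rk M (cover K) = k.+1].

(* A (2, 1, t+1)-spike is, by convention, a (t+1)-point line. *)
Definition spike (r t : nat) : Prop :=
  (r = 2 /\ uniform_matroid 2 t.+1) \/
  (3 <= r /\ exists (a : T) (Ls : {set {set T}}), spike_with_tip r t a Ls).

End MatroidNotions.

(* Main.v *)
(* If F is a large flat of rank i + 1 >= 3 and G, H are distinct large rank-i
   flats inside F, then G :&: H is a flat of rank at most i - 1, so the size
   bounds applied to G :&: H and G :|: H must both be tight: G :|: H = F and
   G :&: H is large.  The complements F :\: G are thus disjoint t-sets, so there
   are at most i of them, and induction on the rank bounds the large flags.  If
   F has i such subflats, then so does each G, with i - 1 in place of i, via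
   H |-> G :&: H.  When the whole matroid has r - 1 large hyperplanes, they meet
   in one point, the tip, and the lines of the spike are the intersections of all
   large hyperplanes but one. *)
Require Import Defs.
From mathcomp Require Import all_boot.
From mathcomp Require Import zify.

Set Implicit Arguments.
Unset Strict Implicit.
Unset Printing Implicit Defensive.

(** * Intersections and closures of flats *)

Section Flats.

Variables (T : finType) (M : matroid T).
Implicit Types (A F G : {set T}).

Lemma rk_ltn_flat F G : flat M F -> F \proper G -> rk M F < rk M G.
Proof.
move=> /forallP flatF /properP[sFG [x xG xF]].
have := implyP (flatF x) xF; move=> /leq_trans; apply.
by apply: rk_mono; rewrite subUset sub1set xG.
Qed.

Lemma flat_setT : flat M [set: T].
Proof. by apply/forallP => x; rewrite inE. Qed.

(** If [x] is outside [F'], submodularity of [x |: F' :&: G'] and [F'] shows that adding [x] raises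
    the rank of [F' :&: G'] at least as much as that of [F']. *)
Lemma flatI F G : flat M F -> flat M G -> flat M (F :&: G).
Proof.
have rk_ltI F' G' x : flat M F' -> x \notin F' ->
    rk M (F' :&: G') < rk M (x |: F' :&: G').
  move=> /forallP/(_ x)/implyP flatF xF; have := flatF xF.
  have := rk_submod M (x |: F' :&: G') F'.
  have -> : (x |: F' :&: G') :|: F' = x |: F'.
    by rewrite -setUA (setUidPr (subsetIl F' G')).
  have -> : (x |: F' :&: G') :&: F' = F' :&: G'.
    rewrite setIUl -setIA (setIC G') setIA setIid.
    suff -> : [set x] :&: F' = set0 by rewrite set0U.
    by apply/disjoint_setI0; rewrite disjoints1.
  lia.
move=> flatF flatG; apply/forallP => x; apply/implyP; rewrite inE negb_and.
case/orP => [xF|xG]; first exact: rk_ltI.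
by rewrite setIC; apply: rk_ltI.
Qed.

Lemma flat_of_rank_cover A : exists2 F, flat_of_rank M (rk M A) F & A \subset F.
Proof.
pose P F := (A \subset F) && (rk M F == rk M A).
have PA : P A by rewrite /P subxx eqxx.
(* A largest superset of [A] with the same rank is closed: any rank-preserving extension would be
   larger. *)
case: (arg_maxnP (fun F => #|F|) PA) => F /andP[sAF /eqP rkF] maxF.
exists F => //; rewrite /flat_of_rank rkF eqxx andbT.
apply/forallP => x; apply/implyP => xF; rewrite ltn_neqAle rk_mono ?subsetUr //.
rewrite andbT rkF; apply/negP => /eqP rkxF.
have := maxF (x |: F); rewrite /P -rkxF eqxx andbT.
rewrite (subset_trans sAF) ?subsetUr // => /(_ isT) /=.
by rewrite cardsU1 xF; lia.
Qed.

End Flats.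

(** * Chains of flats with prescribed sizes *)

Section Chains.

Variables (T : finType) (M : matroid T) (s : nat -> nat).

Definition sized_flat i (F : {set T}) := flat_of_rank M i F && (#|F| == s i).

Definition sized_subflats i (F : {set T}) := [set G : {set T} | sized_flat i G & G \proper F].

(** The end [F] is left free, so that flags can be counted by recursion on the penultimate flat. *)
Definition chains_to i (F : {set T}) :=
  [set f in flag_set M (fun j : 'I_i.+1 => s j) | f ord_max == F].

Lemma chains_toP i F (f : {ffun 'I_i.+1 -> {set T}}) :
  reflect [/\ forall j : 'I_i.+1, sized_flat j (f j),
              forall j k : 'I_i.+1, j < k -> f j \proper f k & f ord_max = F]
          (f \in chains_to i F).
Proof.
rewrite !inE; apply: (iffP andP) => [[/andP[/forallP sf /forallP cf] /eqP fF]|].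
  by split=> // j k; move/forallP/(_ k)/implyP: (cf j).
case=> sf cf /eqP; split=> //; apply/andP; split; first exact/forallP.
by apply/forallP => j; apply/forallP => k; apply/implyP/cf.
Qed.

Lemma card_chains_to0 F : sized_flat 0 F -> #|chains_to 0 F| = 1.
Proof.
move=> sF; apply/eqP/cards1P; exists [ffun=> F]; apply/setP => f.
rewrite in_set1; apply/chains_toP/eqP => [[_ _ fF]|->].
  by apply/ffunP => j; rewrite ffunE ord1 -fF; congr (f _); apply/val_inj.
by split=> [j|j k|]; rewrite ?ffunE ?(ord1 j) ?(ord1 k).
Qed.

Lemma card_chains_toS i F : sized_flat i.+1 F ->
  #|chains_to i.+1 F| = \sum_(G in sized_subflats i F) #|chains_to i G|.
Proof.
(* [p] is the penultimate index [i]; [ext] appends [F] to a chain and [res] drops the last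
   member. *)
move=> sF; pose p : 'I_i.+2 := lift ord_max ord_max.
rewrite -sum1_card (partition_big (fun f : {ffun 'I_i.+2 -> {set T}} => f p)
  (mem (sized_subflats i F))) /=; last first.
  move=> f /chains_toP[sf cf <-]; rewrite inE.
  apply/andP; split; last by apply: cf; rewrite lift_max.
  by have := sf p; rewrite lift_max.
apply: eq_bigr => G; rewrite inE => /andP[sG pGF].
pose ext (g : {ffun 'I_i.+1 -> {set T}}) : {ffun 'I_i.+2 -> {set T}} :=
  [ffun j => if unlift ord_max j is Some k then g k else F].
pose res (f : {ffun 'I_i.+2 -> {set T}}) : {ffun 'I_i.+1 -> {set T}} :=
  [ffun j => f (lift ord_max j)].
have extl g j : ext g (lift ord_max j) = g j by rewrite ffunE liftK.
have extm g : ext g ord_max = F by rewrite ffunE unlift_none.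
have extK : cancel ext res by move=> g; apply/ffunP => j; rewrite ffunE extl.
rewrite (reindex_onto ext res) /=; last first.
  move=> f /andP[/chains_toP[_ _ fF] _]; apply/ffunP => j.
  by rewrite ffunE; case: unliftP => [k ->|->]; rewrite ?ffunE.
rewrite -sum1_card; apply: eq_bigl => g; rewrite extK eqxx andbT extl.
apply/andP/chains_toP => [[/chains_toP[sg cg _] /eqP gG]|[sg cg gG]].
  split=> // [j|j k jk]; first by have := sg (lift ord_max j); rewrite extl lift_max.
  by have := cg (lift ord_max j) (lift ord_max k); rewrite !lift_max !extl; apply.
split; last exact/eqP.
apply/chains_toP; split=> [j|j k|]; last exact: extm.
  by case: (unliftP ord_max j) => [k ->|->]; rewrite ?extl ?extm // lift_max.
case: (unliftP ord_max j) => [j' ->|->]; last by have := ltn_ord k; rewrite /=; lia.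
case: (unliftP ord_max k) => [k' ->|->]; rewrite !extl ?lift_max; first exact: cg.
rewrite extm => _; apply: sub_proper_trans pGF; rewrite -gG.
have [->//|neq] := eqVneq j' ord_max; apply/proper_sub/cg.
by rewrite ltn_neqAle leq_ord andbT; apply: contraNneq neq => ej; apply/eqP/val_inj.
Qed.

Lemma card_flag_set i : #|T| = s i ->
  F0r M (fun j : 'I_i.+1 => s j) = #|chains_to i [set: T]|.
Proof.
move=> cardT; apply: eq_card => f; rewrite [RHS]inE andb_idr //.
rewrite inE => /andP[/forallP/(_ ord_max)/andP[_ /eqP fT] _].
by rewrite eqEcard subsetT fT cardsT cardT /=.
Qed.

End Chains.

(** * Large flats and their large subflats *)

Section LargeFlats.

Variables (T : finType) (M : matroid T) (t : nat).
Hypothesis t_gt1 : 1 < t.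
(** The size bound for arbitrary sets; at rank 0 it excludes loops. *)
Hypothesis card_le_rk : forall A : {set T}, #|A| <= large_size t (rk M A).
Implicit Types (A F G H : {set T}) (S : {set {set T}}).

Let large := sized_flat M (large_size t).
Let D := sized_subflats M (large_size t).

Lemma large_size_mono : {mono large_size t : j k / j <= k}.
Proof. by apply: leq_mono => -[|j] [|k] //=; rewrite ?addn1 // ltnS => jk; nia. Qed.

Lemma large_rkE A i : #|A| = large_size t i -> rk M A <= i -> rk M A = i.
Proof.
move=> cA rkA; apply/eqP; rewrite eqn_leq rkA -large_size_mono -cA.
exact: card_le_rk.
Qed.

Lemma rk_small A : #|A| <= 2 -> rk M A = #|A|.
Proof.
move=> cA; have := card_le_rk A; have := rk_le_card M A.
by case: (rk M A) => [|[|k]] /=; lia.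
Qed.

(** The closure of [A] has the same rank, so the size bound leaves no room for further elements. *)
Lemma large_flat_maximal A i :
  #|A| = large_size t i -> rk M A = i -> large i A.
Proof.
move=> cA rkA; have [F /andP[flF /eqP rkF] sAF] := flat_of_rank_cover M A.
have AF : A = F by apply/eqP; rewrite eqEcard sAF cA -rkA -rkF card_le_rk.
by rewrite /large /sized_flat /flat_of_rank cA rkA {1}AF flF !eqxx.
Qed.

Lemma large_rk i F : large i F -> rk M F = i.
Proof. by case/andP => /andP[_ /eqP]. Qed.

Lemma large_card i F : large i F -> #|F| = large_size t i.
Proof. by case/andP => _ /eqP. Qed.

Lemma large_is_flat i F : large i F -> flat M F.
Proof. by case/andP => /andP[]. Qed.

Lemma large_subflatP i F G : reflect (large i G /\ G \proper F) (G \in D i F).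
Proof. by rewrite inE; apply: andP. Qed.

Lemma large_subflat_pair i F G H : large i.+3 F ->
    G \in D i.+2 F -> H \in D i.+2 F -> G != H ->
  G :|: H = F /\ large i.+1 (G :&: H).
Proof.
move=> lF /large_subflatP[lG pGF] /large_subflatP[lH pHF] neq.
have pI : G :&: H \proper G.
  rewrite properEneq subsetIl andbT; apply: contra neq => /eqP/setIidPl sGH.
  by rewrite eqEcard sGH (large_card lG) (large_card lH) leqnn.
have flI := flatI (large_is_flat lG) (large_is_flat lH).
have := rk_ltn_flat flI pI; rewrite (large_rk lG) ltnS => rkI.
have cI : #|G :&: H| <= large_size t i.+1.
  by apply: leq_trans (card_le_rk _) _; rewrite large_size_mono.
have sUF : G :|: H \subset F by rewrite subUset !proper_sub.
(* The bounds on [G :|: H] and [G :&: H] add up to exactly [#|G| + #|H|], so both are equalities. *)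
have := cardsUI G H; have := subset_leq_card sUF.
rewrite (large_card lG) (large_card lH) (large_card lF) /= => cU cUI.
have {}cI : #|G :&: H| = large_size t i.+1 by move: cI => /=; nia.
split; first by apply/eqP; rewrite eqEcard sUF (large_card lF) /=; move: cI => /=; nia.
exact: large_flat_maximal cI (large_rkE cI rkI).
Qed.

(* F itself is intersected in to make the empty family give F. *)
Lemma large_subflat_bigcap i F S : large i.+3 F -> S \subset D i.+2 F ->
  [/\ flat M (F :&: \bigcap_(G in S) G),
      #|F :&: \bigcap_(G in S) G| + #|S| * t = #|F| &
      rk M (F :&: \bigcap_(G in S) G) + #|S| <= i.+3].
Proof.
move=> lF; have [n] := ubnP #|S|; elim: n S => // n IHn S cS sSD.
have [->|[G GS]] := set_0Vmem S.
  by rewrite big_set0 setIT cards0 !addn0 (large_rk lF) (large_is_flat lF).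
set S' := S :\ G; have cSS' : #|S| = #|S'|.+1 by rewrite (cardsD1 G S) GS.
have sS'D : S' \subset D i.+2 F by apply: subset_trans sSD; apply: subsetDl.
have [flJ cJ rkJ] := IHn S' ltac:(lia) sS'D.
have GD := subsetP sSD _ GS; have [lG pGF] := large_subflatP _ _ _ GD.
rewrite (big_setD1 G) //= -/S' (setIC G) setIA.
set J := F :&: \bigcap_(H in S') H in flJ cJ rkJ *.
(* Every other member [H] satisfies [G :|: H = F], hence contains [F :\: G]. Intersecting with [G]
   thus removes a full [t] elements, and the rank drops. *)
have JDG : J :\: G = F :\: G.
  apply/eqP; rewrite eqEsubset setSD ?subsetIl //=; apply/subsetP => x.
  rewrite !inE => /andP[xG xF]; rewrite xG xF /=; apply/bigcapP => H.
  rewrite !inE => /andP[HG HS].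
  have [UF _] := large_subflat_pair lF (subsetP sSD _ HS) GD HG.
  by move: xF; rewrite -UF inE (negPf xG) orbF.
have := cardsID G J; have := cardsID G F.
rewrite JDG (setIidPr (proper_sub pGF)) (large_card lG) {1}(large_card lF) /=.
move=> cF cJG; have cFG : #|F :\: G| = t by nia.
have flJG := flatI flJ (large_is_flat lG).
have pJG : J :&: G \proper J.
  by rewrite properEcard subsetIl -cJG cFG; lia.
have rkJG := rk_ltn_flat flJG pJG.
by split=> //; rewrite cSS'; [nia|lia].
Qed.

Lemma card_large_subflats_le i F : large i.+3 F -> #|D i.+2 F| <= i.+2.
Proof.
move=> lF; have [_ + _] := large_subflat_bigcap lF (subxx _).
(* Here [1 < t] absorbs the extra element: [i.+2 * t + 1 < i.+3 * t]. *)
rewrite (large_card lF) /= => cJ; rewrite -ltnS -(ltn_pmul2r (ltnW t_gt1)).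
apply: (@leq_ltn_trans (i.+2 * t + 1)); last by lia.
by rewrite -cJ leq_addl.
Qed.

Lemma large_bigcap i F S : large i.+3 F -> S \subset D i.+2 F ->
  large (i.+3 - #|S|) (F :&: \bigcap_(G in S) G).
Proof.
move=> lF sSD; have [_ cJ rkJ] := large_subflat_bigcap lF sSD.
have cS := leq_trans (subset_leq_card sSD) (card_large_subflats_le lF).
have {}cJ : #|F :&: \bigcap_(G in S) G| = large_size t (i.+3 - #|S|).
  (* Since [#|S| <= i.+2], the rank [i.+3 - #|S|] is positive and [large_size] is in its linear
     case. *)
  move: cJ; rewrite (large_card lF) (subSn cS) /= mulnBl => cJ.
  by rewrite addnBAC ?leq_mul2r ?cS ?orbT // -cJ addnK.
apply: (large_flat_maximal cJ); apply: (large_rkE cJ).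
by rewrite leq_subRL ?(leqW cS) // addnC.
Qed.

(** Only an inequality holds in general: for [i = 0], [G] is a line with [t + 1] large points. *)
Lemma card_large_subflats_hereditary i F G : large i.+3 F ->
  #|D i.+2 F| = i.+2 -> G \in D i.+2 F -> i.+1 <= #|D i.+1 G|.
Proof.
move=> lF cD GD; have [lG pGF] := large_subflatP _ _ _ GD.
have cI : #|[set G :&: H | H in D i.+2 F :\ G]| = i.+1.
  rewrite card_in_imset; first by have := cardsD1 G (D i.+2 F); rewrite GD cD; lia.
  have recover H : H \in D i.+2 F :\ G -> H = (G :&: H) :|: (F :\: G).
    rewrite in_setD1 => /andP[HG HD].
    have [<- _] := large_subflat_pair lF HD GD HG.
    by rewrite setDUl setDv setU0 setIC setID.
  by move=> H H' /recover {2}-> /recover {2}-> ->.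
rewrite -[leqLHS]cI.
apply/subset_leq_card/subsetP => _ /imsetP[H /setD1P[HG HD] ->].
rewrite eq_sym in HG; have [_ lI] := large_subflat_pair lF GD HD HG.
apply/large_subflatP; split=> //; rewrite properEcard subsetIl.
by rewrite (large_card lI) (large_card lG) /=; nia.
Qed.

(** * Counting large flags *)

Lemma large0 : large 0 set0.
Proof. by apply: large_flat_maximal; rewrite ?rk_small cards0. Qed.

Lemma large_set1 x : large 1 [set x].
Proof. by apply: large_flat_maximal; rewrite ?rk_small cards1. Qed.

Lemma card_chains_to_point G : large 1 G -> #|chains_to M (large_size t) 1 G| = 1.
Proof.
move=> lG; rewrite card_chains_toS // (_ : sized_subflats _ _ _ _ = [set set0]).
  by rewrite big_set1; apply: card_chains_to0 large0.
apply/setP => H; rewrite in_set1; apply/large_subflatP/eqP => [[lH _]|->].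
  by apply/eqP; rewrite -cards_eq0 (large_card lH).
by split; [exact: large0|rewrite proper0 -cards_eq0 (large_card lG)].
Qed.

(** The base case and the source of the factor [t.+1]: every point of a line is large. *)
Lemma card_chains_to_line F : large 2 F -> #|chains_to M (large_size t) 2 F| = t.+1.
Proof.
move=> lF; rewrite card_chains_toS // (_ : sized_subflats _ _ _ _ = set1 @: F).
  rewrite big_imset /=; last by move=> x y _ _; apply: set1_inj.
  rewrite (eq_bigr (fun=> 1)); last by move=> x _; apply: card_chains_to_point (large_set1 x).
  by rewrite sum1_card (large_card lF) /=; lia.
apply/setP => G; apply/large_subflatP/imsetP => [[lG pGF]|[x xF ->]].
  have /cards1P[x Gx] : #|G| == 1 by rewrite (large_card lG).
  by exists x => //; rewrite -sub1set -Gx proper_sub.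
split; first exact: large_set1.
by rewrite properEcard sub1set xF cards1 (large_card lF) /=; lia.
Qed.

Lemma card_chains_to_le i F : large i.+2 F ->
  #|chains_to M (large_size t) i.+2 F| <= i.+1`! * t.+1.
Proof.
elim: i F => [|i IHi] F lF; first by rewrite card_chains_to_line // factS fact0 !mul1n.
rewrite card_chains_toS //.
apply: (@leq_trans (#|D i.+2 F| * (i.+1`! * t.+1))).
  by rewrite -sum_nat_const; apply: leq_sum => G /large_subflatP[lG _]; apply: IHi.
by rewrite (factS i.+1) -mulnA leq_mul2r card_large_subflats_le ?orbT.
Qed.

(** Fewer than [i.+2] subflats would already lose a factor. Conversely, a full set of subflats is
    inherited at each rank down to the lines, making every factor tight. *)
Lemma card_chains_to_eq i F : large i.+3 F ->
  #|chains_to M (large_size t) i.+3 F| = i.+2`! * t.+1 <-> #|D i.+2 F| = i.+2.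
Proof.
move=> lF; split=> [eqK|].
  apply/eqP; rewrite eqn_leq card_large_subflats_le //=.
  have pos : 0 < i.+1`! * t.+1 by rewrite muln_gt0 fact_gt0.
  rewrite -(leq_pmul2r pos) mulnA -factS -eqK card_chains_toS // -sum_nat_const.
  by apply: leq_sum => G /large_subflatP[lG _]; apply: card_chains_to_le.
elim: i F lF => [|i IHi] F lF cD.
  rewrite card_chains_toS // (eq_bigr (fun=> t.+1)).
    by rewrite sum_nat_const cD.
  by move=> G /large_subflatP[lG _]; apply: card_chains_to_line.
rewrite card_chains_toS // (eq_bigr (fun=> i.+2`! * t.+1)).
  by rewrite sum_nat_const cD (factS i.+2) mulnA.
move=> G GD; have [lG _] := large_subflatP _ _ _ GD; apply: IHi => //.
apply/eqP; rewrite eqn_leq card_large_subflats_le //.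
exact: card_large_subflats_hereditary lF cD GD.
Qed.

(** * Large hyperplanes and spikes *)

Section Spikes.

Variable i : nat.
Hypothesis largeT : large i.+3 [set: T].
Let hyp := D i.+2 [set: T].

Lemma spike_of_large_subflats : #|hyp| = i.+2 ->
  exists a Ls, spike_with_tip M i.+3 t a Ls.
Proof.
move=> cD; pose J S := [set: T] :&: \bigcap_(H in S) H.
have lJ S : S \subset hyp -> large (i.+3 - #|S|) (J S) := large_bigcap largeT.
have JP x S : reflect (forall H, H \in S -> x \in H) (x \in J S).
  by rewrite inE in_setT; apply: bigcapP.
(* Intersecting all [i.+2] hyperplanes leaves rank [i.+3 - i.+2 = 1], hence a single point. *)
have /cards1P[a Ja] : #|J hyp| == 1.
  by rewrite (large_card (lJ _ (subxx _))) cD subSnn.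
have aJ S : S \subset hyp -> a \in J S.
  move=> /subsetP sS; apply/JP => H /sS; move: H; apply/JP.
  by rewrite Ja set11.
pose L H := J (hyp :\ H).
have sD S : hyp :\: S \subset hyp by apply: subsetDl.
have lL H : H \in hyp -> large 2 (L H).
  move=> Hh; have := lJ _ (sD [set H]); rewrite -/(L H).
  suff -> : i.+3 - #|hyp :\ H| = 2 by [].
  by have := cardsD1 H hyp; rewrite Hh cD; lia.
have injL : {in hyp &, injective L}.
  move=> H H' Hh Hh' eL; apply/eqP; apply/negPn/negP => neq.
  suff /subset_leq_card : L H \subset J hyp.
    by rewrite (large_card (lL _ Hh)) Ja cards1 /=; lia.
  apply/subsetP => x xL; apply/JP => G Gh; have [GH|GH] := eqVneq G H.
    by move: xL; rewrite eL => /JP; apply; rewrite !inE GH neq /= -GH; rewrite inE in Gh.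
  by move/JP: xL; apply; rewrite in_setD1 GH.
(* Two distinct large hyperplanes cover the ground set, so a point misses at most one of them, [H],
   and then lies in [L H]. A point on all of them lies in every [L H], which is why [S] must be
   nonempty. *)
have bigL S : S \subset hyp -> S != set0 -> \bigcup_(H in S) L H = J (hyp :\: S).
  move=> sS /set0Pn[H0 H0S]; apply/setP => x; apply/bigcupP/JP => [[H HS /JP xL] G|xJ].
    rewrite in_setD => /andP[GS Gh]; apply: xL; rewrite in_setD1 Gh andbT.
    by apply: contraNneq GS => ->.
  have [/JP xJh|] := boolP (x \in J hyp).
    by exists H0 => //; apply/JP => G /setD1P[_]; apply: xJh.
  move=> /JP nx; have [H /andP[Hh xH]|no] := pickP [pred H | (H \in hyp) && (x \notin H)].
    have HS : H \in S by apply: contraNT xH => HS; apply: xJ; rewrite in_setD HS.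
    exists H => //; apply/JP => G /setD1P[GH Gh].
    have [UT _] := large_subflat_pair largeT Gh Hh GH.
    by have := in_setT x; rewrite -UT in_setU (negPf xH) orbF.
  by case: nx => H Hh; have := no H; rewrite /= Hh => /negbFE.
have rkL S : S \subset hyp -> S != set0 -> rk M (\bigcup_(H in S) L H) = #|S|.+1.
  move=> sS S0; rewrite bigL // (large_rk (lJ _ (sD S))).
  have := cardsID S hyp; rewrite (setIidPr sS) cD => cS.
  by rewrite -[i.+3]/(i.+2.+1) -cS -addSn addnK.
have hyp0 : hyp != set0 by rewrite -card_gt0 cD.
exists a, (L @: hyp); split.
- exact: rk_small.
- exact: large_rk largeT.
- split; first by rewrite card_in_imset.
  rewrite cover_imset bigL // setDv; apply/setP => x; rewrite in_setT.
  by apply/JP => H; rewrite in_set0.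
- move=> _ /imsetP[H Hh ->]; have /andP[fl2 /eqP c2] := lL _ Hh.
  by split=> //; [rewrite c2 /=; lia | apply: aJ].
move=> k K /andP[k_gt0 _] /subsetP sK cK.
(* Lines are pulled back along [L] to hyperplanes, where [rkL] gives the rank of the union. *)
have KE : K = L @: [set H in hyp | L H \in K].
  apply/setP => X; apply/idP/imsetP => [XK|[H /setIdP[_ HK] ->] //].
  by have /imsetP[H Hh XL] := sK _ XK; exists H => //; rewrite in_set Hh -XL.
set S := [set H in hyp | _] in KE; have sS : S \subset hyp by apply/subsetP => H /setIdP[].
have cS : #|S| = k.
  rewrite -cK KE card_in_imset // => H H' HS HS'.
  by apply: injL; apply: (subsetP sS).
by rewrite KE cover_imset rkL ?cS // -card_gt0 cS.
Qed.

Lemma large_subflats_of_spike a Ls :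
  spike_with_tip M i.+3 t a Ls -> #|hyp| = i.+2.
Proof.
case=> _ _ [cLs coverLs] lineP rkLs.
apply/eqP; rewrite eqn_leq card_large_subflats_le //=.
(* The hyperplane attached to a line is the union of all the other lines. *)
pose H L := cover (Ls :\ L).
have cDL L : L \in Ls -> #|Ls :\ L| = i.+1.
  by move=> LLs; have := cardsD1 L Ls; rewrite LLs cLs /=; lia.
have rkH L : L \in Ls -> rk M (H L) = i.+2.
  by move=> LLs; rewrite (rkLs i.+1) ?cDL ?subsetDl //=.
have aH L : L \in Ls -> a \in H L.
  move=> LLs; have : 0 < #|Ls :\ L| by rewrite cDL.
  case/card_gt0P => L' /[dup] L'D /setD1P[_ /lineP[_ _ aL']].
  by apply/bigcupP; exists L'.
have UT L : L \in Ls -> L :|: H L = [set: T].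
  by move=> LLs; rewrite -coverLs /H /cover [RHS](big_setD1 L).
(* [L] and [H L] cover the ground set and share [a], so [H L] has at least [#|T| - t] elements. The
   size bound allows no more, so [a] is their only common point. *)
have cH L : L \in Ls -> #|H L| = large_size t i.+2 /\ L :&: H L = [set a].
  move=> LLs; have [_ cL aL] := lineP _ LLs.
  have saI : [set a] \subset L :&: H L by rewrite sub1set inE aL aH.
  have := card_le_rk (H L); rewrite rkH //.
  have := cardsUI L (H L); have := subset_leq_card saI.
  rewrite UT // cL (large_card largeT) cards1 /= => c1 cUI cH.
  split; first nia.
  by apply/esym/eqP; rewrite eqEcard saI cards1; nia.
have recover L : L \in Ls -> L = a |: ~: H L.
  move=> LLs; have [_ <-] := cH _ LLs.
  rewrite setUIl -setTD -(UT _ LLs) setDUl setDv setU0.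
  rewrite (setUidPl (subsetDl _ _)) setUC setDE.
  by apply/esym/setIidPl/subsetP => x xL; rewrite !inE xL; case: (x \in H L).
have injH : {in Ls &, injective H}.
  by move=> L L' /recover {2}-> /recover {2}-> ->.
rewrite -[leqLHS]cLs -(card_in_imset injH).
apply/subset_leq_card/subsetP => _ /imsetP[L LLs ->]; have [cHL _] := cH _ LLs.
apply/large_subflatP; split; first exact: large_flat_maximal cHL (rkH _ LLs).
by rewrite properEcard subsetT cHL (large_card largeT) /=; nia.
Qed.

End Spikes.

End LargeFlats.

Theorem theorem7p2 (r t : nat) (hr : 2 <= r) (ht : 2 <= t)
    (T : finType) (M : matroid T)
    (hrank : rk M [set: T] = r)
    (hcard : #|T| = r.-1 * t + 1)
    (hflats : forall (i : nat) (F : {set T}), 1 <= i <= r ->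
       flat_of_rank M i F -> #|F| <= i.-1 * t + 1) :
  [/\ num_large_flags M r t <= (r.-1)`! * t.+1,
      num_large_flags M r t = (r.-1)`! * t.+1 <-> spike M r t &
      2 < r ->
        #|large_hyperplanes M r t| <= r.-1 /\
        (num_large_flags M r t = (r.-1)`! * t.+1 <->
         #|large_hyperplanes M r t| = r.-1)].
Proof.
have rk_le A : rk M A <= r by rewrite -hrank rk_mono ?subsetT.
(* Closures extend the bound from flats to all sets of positive rank. *)
have card_le1 A : 0 < rk M A -> #|A| <= large_size t (rk M A).
  move=> rkA; have [F flF sAF] := flat_of_rank_cover M A.
  apply: leq_trans (subset_leq_card sAF) _.
  by have := hflats _ F _ flF; rewrite rkA rk_le; case: (rk M A) rkA => //= j _; apply.
(* The hypothesis says nothing about rank 0; a loop would lie in every rank-1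
   flat, which has only one element. *)
have card_le (A : {set T}) : #|A| <= large_size t (rk M A).
  have [rkA|] := posnP (rk M A); last exact: card_le1.
  rewrite rkA leqn0 cards_eq0; apply/negPn/negP => A0.
  have [F /andP[flF /eqP rkF] sAF] := flat_of_rank_cover M A.
  have [x xF] : exists x, x \notin F.
    apply/existsP; rewrite -negb_forall; apply/negP => /forallP FT.
    suff FE : F = [set: T] by move: hr; rewrite -hrank -FE rkF rkA.
    by apply/setP => x; rewrite FT inE.
  have := rk_submod M [set x] F; have := rk_le_card M [set x].
  have := implyP (forallP flF x) xF; rewrite rkF rkA cards1 => rkx rk1 submod.
  have rkxF : rk M (x |: F) = 1 by lia.
  have := card_le1 (x |: F); rewrite rkxF cardsU1 xF /= => /(_ isT).
  by have := subset_leq_card sAF; rewrite -card_gt0 in A0; lia.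
have largeT : sized_flat M (large_size t) r [set: T].
  rewrite /sized_flat /flat_of_rank flat_setT hrank eqxx cardsT hcard.
  by case: (r) hr => //=.
have flagsE : num_large_flags M r t = #|chains_to M (large_size t) r [set: T]|.
  by apply: card_flag_set => //; rewrite -cardsT; have /andP[_ /eqP] := largeT.
rewrite flagsE.
case: r hr hrank hcard hflats rk_le largeT flagsE => [|[|[|i]]] // _ hrank hcard _ rk_le largeT _.
  (* In rank 2 both sides of the equivalence always hold: there are [t.+1] flags, and the size bound
     gives rank 2 to every set with more than two elements. *)
  have eqK := card_chains_to_line ht card_le largeT.
  rewrite [_.-1]/= factS fact0 !mul1n; split=> //; first by rewrite eqK.
  split=> // _; left; split=> //; split; first by rewrite hcard /=; lia.
  move=> A; have [cA|cA] := leqP #|A| 2.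
    exact: rk_small ht card_le _ cA.
  apply/eqP; rewrite eqn_leq rk_le /=.
  have := card_le A; move: (rk_le A).
  by case: (rk M A) => [|[|k]] //=; lia.
(* A large hyperplane has fewer elements than the ground set, so properness is automatic. *)
have hypE : large_hyperplanes M i.+3 t = sized_subflats M (large_size t) i.+2 [set: T].
  apply/setP => H; rewrite !inE /large_flat /sized_flat /=.
  have [cH|] := eqVneq #|H| _; rewrite ?andbF //= andbT.
  by rewrite properEcard subsetT cH cardsT hcard /=; case: (flat_of_rank _ _ _); nia.
have eqK := card_chains_to_eq ht card_le largeT.
split; first exact: card_chains_to_le.
- rewrite eqK; split=> [cD|[[//]|[_ [a [Ls spk]]]]].
    by right; split=> //; apply: spike_of_large_subflats cD.
  exact: large_subflats_of_spike spk.
- by move=> _; rewrite hypE; split; first exact: card_large_subflats_le.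
Qed.
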